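(* There is an algorithm which, given $\lambda=-u^2\in\mathbb C$ and a positive integer $k$, decides whether $\lambda$ is a relation number with minimal $u$-degree $k$; i.e. it always terminates and correctly decides whether $\operatorname{mindeg}_u(\lambda)=k$.
   Context: For an integer sequence $\mathbf n=(n_1,n_2,\dots)$: $s^{\mathbf n}_0(t)=0$, $s^{\mathbf n}_1(t)=1$, $s^{\mathbf n}_{j+1}(t)=n_j\,t\,s^{\mathbf n}_j(t)-s^{\mathbf n}_{j-1}(t)$. For $\lambda=-u^2\in\mathbb C$, the minimal $u$-degree $\operatorname{mindeg}_u(\lambda)$ is the minimal length $k\geq 1$ of a sequence $\mathbf n=(n_1,\dots,n_k)$ of nonzero integers such that $s^{\mathbf n}_{k+1}(u)=0$, and $\operatorname{mindeg}_u(\lambda)=\infty$ if no such sequence exists. ($\lambda$ is called a relation number if the subgroup of $SL(2,\mathbb C)$ generated by $\begin{pmatrix}1&1\\0&1\end{pmatrix}$ and $\begin{pmatrix}1&0\\ \lambda&1\end{pmatrix}$ is not free of rank $2$; a nonzero $\lambda$ is a relation number iff $\operatorname{mindeg}_u(\lambda)<\infty$.) Model of computation: $\lambda$ is given as an exact complex number, and the algorithm may use exact arithmetic: field operations in $\mathbb C$, real and imaginary parts, absolute values (real square roots), floor and ceiling of reals, and equality/order tests of reals. *)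

(* Defs.v *)
From mathcomp Require Import all_boot all_order all_algebra.
From mathcomp Require Import boolp reals complex.

Set Implicit Arguments.
Unset Strict Implicit.
Unset Printing Implicit Defensive.

Import Order.TTheory GRing.Theory Num.Theory.

Local Open Scope ring_scope.
Local Open Scope complex_scope.

(* The value at t of the j-th polynomial s_j attached to n_1, n_2, ...;
   the entry n 0 is never used. *)
Fixpoint s_ (A : pzRingType) (n : nat -> int) (t : A) (j : nat) : A :=
  match j with
  | 0%N => 0
  | j'.+1 => match j' with
             | 0%N => 1
             | j''.+1 => (n j')%:~R * t * s_ n t j' - s_ n t j''
             end
  end.

(* n_1, ..., n_k is stored as a list, whose positions start at 0. *)
Definition vanishing_length (R : realType) (u : R[i]) (k : nat) : Prop :=
  exists n : seq int,
    [/\ size n = k, 0 \notin n & s_ (fun j => n`_j.-1) u k.+1 = 0].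

(* The minimal u-degree of - u ^+ 2, where None stands for infinity. *)
Definition mindeg_u (R : realType) (u : R[i]) : option nat :=
  match pselect (exists k, (0 < k)%N && `[< vanishing_length u k >]) with
  | left ex_k => Some (ex_minn ex_k)
  | right _ => None
  end.

(* Algorithms are the programs of a WHILE language over a memory of complex
   registers indexed by nat. A program is a finite object in which integers are
   the only literals. Operations and tests on reals act on the real part of
   their operands. Every operation is total, with the conventions of the
   library: z / 0 = 0, and Num.sqrt is 0 on negative reals. *)
Inductive expr : Type :=
  | Lit of int
  | Get of expr
  | Add of expr & expr
  | Sub of expr & expr
  | Mul of expr & expr
  | Div of expr & expr
  | RePart of expr
  | ImPart of expr
  | Abs of expr
  | Sqrt of expr
  | Floor of expr
  | Ceil of expr.

Inductive test : Type :=
  | TEq of expr & expr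
  | TLe of expr & expr
  | TNot of test
  | TAnd of test & test.

Inductive prog : Type :=
  | Skip
  | Set_ of expr & expr
  | Seq of prog & prog
  | If of test & prog & prog
  | While of test & prog.

Definition memory (R : realType) : Type := nat -> R[i].

(* Registers are addressed by values: the natural number m denotes register m,
   and in general the real part is truncated to a natural number. *)
Definition address (R : realType) (z : R[i]) : nat :=
  Num.truncn (complex.Re z).

Fixpoint eval (R : realType) (m : memory R) (e : expr) : R[i] :=
  match e with
  | Lit z => z%:~R
  | Get a => m (address (eval m a))
  | Add e1 e2 => eval m e1 + eval m e2
  | Sub e1 e2 => eval m e1 - eval m e2
  | Mul e1 e2 => eval m e1 * eval m e2
  | Div e1 e2 => eval m e1 / eval m e2
  | RePart e1 => (complex.Re (eval m e1))%:C
  | ImPart e1 => (complex.Im (eval m e1))%:C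
  | Abs e1 => `|eval m e1|
  | Sqrt e1 => (Num.sqrt (complex.Re (eval m e1)))%:C
  | Floor e1 => (Num.floor (complex.Re (eval m e1)))%:~R
  | Ceil e1 => (Num.ceil (complex.Re (eval m e1)))%:~R
  end.

Fixpoint holds (R : realType) (m : memory R) (b : test) : bool :=
  match b with
  | TEq e1 e2 => complex.Re (eval m e1) == complex.Re (eval m e2)
  | TLe e1 e2 => complex.Re (eval m e1) <= complex.Re (eval m e2)
  | TNot b1 => ~~ holds m b1
  | TAnd b1 b2 => holds m b1 && holds m b2
  end.

Definition update (R : realType) (m : memory R) (a : nat) (z : R[i]) :
  memory R := fun x => if x == a then z else m x.

(* exec P m m': started in memory m, P terminates, in memory m'. *)
Inductive exec (R : realType) : prog -> memory R -> memory R -> Prop :=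
  | exec_skip m : exec Skip m m
  | exec_set m a e :
      exec (Set_ a e) m (update m (address (eval m a)) (eval m e))
  | exec_seq m1 m2 m3 P Q :
      exec P m1 m2 -> exec Q m2 m3 -> exec (Seq P Q) m1 m3
  | exec_if m m' b P Q :
      exec (if holds m b then P else Q) m m' -> exec (If b P Q) m m'
  | exec_while_end m b P : ~~ holds m b -> exec (While b P) m m
  | exec_while_step m1 m2 m3 b P :
      holds m1 b -> exec P m1 m2 -> exec (While b P) m2 m3 ->
      exec (While b P) m1 m3.

Lemma exec_det (R : realType) (P : prog) (m m1 m2 : memory R) :
  exec P m m1 -> exec P m m2 -> m1 = m2.
Proof.
move=> E1; elim: E1 m2 => {P m m1}.
- by move=> m m2 E; inversion E.
- by move=> m a e m2 E; inversion E.
- move=> m1 m2 m3 P Q _ IHP _ IHQ m4 E; inversion E; subst.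
  by apply: IHQ; rewrite (IHP m5).
- by move=> m m' b P Q _ IH m2 E; inversion E; subst; apply: IH.
- move=> m b P nb m2 E; inversion E; subst=> //.
  by rewrite (negbTE nb) in H1.
- move=> m1 m2 m3 b P hb _ IHP _ IHW m4 E; inversion E; subst.
    by rewrite hb in H3.
  by apply: IHW; rewrite (IHP m5).
Qed.

Definition input (R : realType) (lambda : R[i]) (k : nat) : memory R :=
  fun x => match x with 0%N => lambda | 1%N => k%:R | _ => 0 end.

(* P terminates on input (lambda, k), answering 1 (yes) or 0 (no) in
   register 0 according to whether A holds. *)
Definition decides_on (R : realType) (P : prog) (lambda : R[i]) (k : nat)
    (A : Prop) : Prop :=
  exists2 m : memory R, exec P (input lambda k) m &
    (A /\ m 0%N = 1) \/ (~ A /\ m 0%N = 0).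

(* Main.v *)
(* Put v = u^2 = - lambda. The scaled values q_j = u^(j-1) s_j(u) satisfy
   q_(j+1) = v (n_j q_j - q_(j-1)), so only lambda is needed to compute them,
   and the minimal length of a zero of q is the minimal u-degree.
   If no zero is shorter than k, and if A bounds |q| + 1/|q| on all sequences
   of length at most k with nonzero entries of size at most N, then a zero of
   length k with some entry > N has one below 7 A^2 among those: the blocks of
   small entries are bounded away from 0, and the large entries dominate the
   rest. So a shortest zero with r entries <= N and some entry > N has at least
   r + 1 entries <= N + 7 A^2. Starting from N = 1, enlarging the bound k times
   in this way therefore captures every shortest zero, and a finite enumeration
   finds its length. *)
Require Import Defs.
From mathcomp Require Import all_boot all_order all_algebra.
From mathcomp Require Import boolp reals complex.
From mathcomp Require Import zify ring lra.

Import Order.TTheory GRing.Theory Num.Theory.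
Local Open Scope ring_scope.
Local Open Scope complex_scope.

Local Notation normc := ComplexField.Normc.normc.
Local Arguments ComplexField.Normc.normc : simpl never.

(** * The scaled recurrence and its relation to s_j *)

(* Maps (q_(j-1), q_j) to (q_j, q_(j+1)), where n = n_j. *)
Definition qstep {A : comPzRingType} (v : A) (pq : A * A) (n : int) : A * A :=
  (pq.2, v * (n%:~R * pq.2 - pq.1)).

Definition qpair {A : comPzRingType} (v : A) (z : seq int) : A * A :=
  foldl (qstep v) (0, 1) z.

Definition q_ {A : comPzRingType} (v : A) (z : seq int) : A := (qpair v z).2.

Lemma qpair_rcons {A : comPzRingType} (v : A) z n :
  qpair v (rcons z n) = (q_ v z, v * (n%:~R * q_ v z - (qpair v z).1)).
Proof. by rewrite /qpair foldl_rcons. Qed.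

(** Each step is linear in the pair, so the runs from [(0, 1)] and [(1, 0)] determine all others. *)
Lemma foldl_qstep_linear {A : comPzRingType} (v x y : A) z :
  foldl (qstep v) (x, y) z =
  (y * (qpair v z).1 + x * (foldl (qstep v) (1, 0) z).1,
   y * q_ v z + x * (foldl (qstep v) (1, 0) z).2).
Proof.
elim/last_ind: z => [|z n IH]; first by rewrite /q_ /=; congr (_, _); ring.
by rewrite foldl_rcons IH /q_ qpair_rcons foldl_rcons /qstep /=; congr (_, _); ring.
Qed.

(** One step takes [(1, 0)] to [(0, - v)], a multiple of the standard start, so the component x
    contributes [- v * x * q_ v z]. *)
Lemma foldl_qstep_cons {A : comPzRingType} (v x y : A) n z :
  (foldl (qstep v) (x, y) (n :: z)).2 = y * q_ v (n :: z) - v * x * q_ v z.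
Proof.
have -> : q_ v (n :: z) = v * n%:~R * q_ v z + (foldl (qstep v) (1, 0) z).2.
  by rewrite [LHS]/q_ /qpair /= /qstep foldl_qstep_linear /=; ring.
by rewrite /= /qstep foldl_qstep_linear /=; ring.
Qed.

Lemma q_s_ {A : comPzRingType} (u : A) (n : seq int) j : (j <= size n)%N ->
  qpair (u ^+ 2) (take j n) =
  (u ^+ j.-1 * s_ (fun i => n`_i.-1) u j, u ^+ j * s_ (fun i => n`_i.-1) u j.+1).
Proof.
elim: j => [|j IH] ltjn; first by rewrite take0 /qpair /= mulr0 mulr1.
rewrite (take_nth 0) // qpair_rcons /q_ IH 1?ltnW //=; congr (_, _).
case: j {IH} ltjn => [|j] ltjn /=; first by rewrite !expr0 expr1 expr2; ring.
by rewrite !exprS; ring.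
Qed.

Definition zero_length {A : comPzRingType} (v : A) (d : nat) : Prop :=
  exists z : seq int, [/\ size z = d, 0 \notin z & q_ v z = 0].

Lemma mindeg_uE (R : realType) (u : R[i]) (k : nat) : (0 < k)%N ->
  mindeg_u u = Some k <->
  zero_length (u ^+ 2) k /\
  forall d, (0 < d)%N -> zero_length (u ^+ 2) d -> (k <= d)%N.
Proof.
move=> k_gt0.
have qE (n : seq int) :
    q_ (u ^+ 2) n = u ^+ size n * s_ (fun i => n`_i.-1) u (size n).+1.
  by rewrite /q_ -[n in qpair _ n]take_size q_s_.
have zl d : vanishing_length u d -> zero_length (u ^+ 2) d.
  by case=> n [sn n0 s0]; exists n; split=> //; rewrite qE sn s0 mulr0.
(* For u = 0 every nonempty sequence is a zero of q, but not always of s. There [[:: 1]] serves, so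
   only a length at most d is obtained. *)
have lz d : (0 < d)%N -> zero_length (u ^+ 2) d ->
    exists e, [/\ (0 < e)%N, (e <= d)%N & vanishing_length u e].
  move=> d_gt0 [n [sn n0]].
  have [-> _|u0] := eqVneq u 0.
    by exists 1%N; split=> //; exists [:: 1]; split=> //=; rewrite mulr0 mul0r subr0.
  rewrite qE sn => /eqP; rewrite mulf_eq0 expf_eq0 (negPf u0) andbF /= => /eqP s0.
  by exists d; split=> //; exists n.
rewrite /mindeg_u; case: pselect => [ex_k|no_k].
  case: ex_minnP => m /andP[m_gt0 /asboolP vm] m_min; split=> [[<-]|[zk k_min]].
    split=> [|d d_gt0 /(lz _ d_gt0)[e [e_gt0 le_ed ve]]]; first exact: zl.
    by apply: leq_trans le_ed; apply: m_min; rewrite e_gt0; apply/asboolP.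
  have [e [e_gt0 le_ek ve]] := lz _ k_gt0 zk.
  congr Some; apply/eqP; rewrite eqn_leq (k_min m) ?andbT //; last exact: zl.
  by apply: leq_trans le_ek; apply: m_min; rewrite e_gt0; apply/asboolP.
split=> // -[zk _]; case: no_k; have [e [e_gt0 _ ve]] := lz _ k_gt0 zk.
by exists e; rewrite e_gt0; apply/asboolP.
Qed.


(** * Complex norms as real numbers *)

Lemma normr_normc {R : realType} (z : R[i]) : `|z| = (normc z)%:C.
Proof. by rewrite normc_def; case: z. Qed.

Lemma normc_ge0 {R : realType} (z : R[i]) : 0 <= normc z.
Proof. by rewrite -ler0c -normr_normc. Qed.

Lemma normc_eq0 {R : realType} (z : R[i]) : (normc z == 0) = (z == 0).
Proof. by rewrite -(inj_eq (@complexI R)) -normr_normc normr_eq0. Qed.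

Lemma normcM {R : realType} (x y : R[i]) : normc (x * y) = normc x * normc y.
Proof. exact: ComplexField.Normc.normcM. Qed.

Lemma normc_int {R : realType} (n : int) : normc (n%:~R : R[i]) = `|n|%N%:R.
Proof.
by apply: complexI; rewrite -normr_normc -intr_norm -abszE -pmulrn rmorph_nat.
Qed.

Lemma normcB_le {R : realType} (x y : R[i]) : normc (x - y) <= normc x + normc y.
Proof. by rewrite -lecR rmorphD /= -!normr_normc ler_normB. Qed.

Lemma normcB_ge {R : realType} (x y : R[i]) : normc x - normc y <= normc (x - y).
Proof. by rewrite -lecR rmorphB /= -!normr_normc lerB_dist. Qed.

(** * Perturbation estimates for sequences with large entries *)

(** As [0^-1 = 0], zeros of q satisfy this whenever [0 <= A]; otherwise it gives both [|q| <= A] and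
    [1 <= A |q|]. *)
Definition tame {R : realType} (v : R[i]) (A : R) (z : seq int) : Prop :=
  normc (q_ v z) + (normc (q_ v z))^-1 <= A.

Lemma tame_bounds {R : realType} (v : R[i]) (A : R) z : q_ v z != 0 -> tame v A z ->
  normc (q_ v z) <= A /\ 1 <= A * normc (q_ v z).
Proof.
rewrite -normc_eq0 /tame; set a := normc _ => a_neq0 le_A.
have a_gt0 : 0 < a by rewrite lt_neqAle eq_sym a_neq0 normc_ge0.
have Va_gt0 : 0 < a^-1 by rewrite invr_gt0.
split; first lra.
by rewrite -ler_pdivrMr // div1r; lra.
Qed.

(** Across a tame block, the last inequality keeps the second term in [foldl_qstep_cons] at most
    half of the first. *)
Definition large_pair {R : realType} (v : R[i]) (A : R) (pq : R[i] * R[i]) : Prop :=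
  [/\ pq.2 != 0, normc pq.1 <= normc pq.2 &
    2 * A ^+ 2 * normc v * normc pq.1 <= normc pq.2].

Definition tame_infixes {R : realType} (v : R[i]) (A : R) (z : seq int) : Prop :=
  forall s, infix s z -> s != [::] -> q_ v s != 0 /\ tame v A s.

Lemma tame_infixesS {R : realType} (v : R[i]) (A : R) s z :
  infix s z -> tame_infixes v A z -> tame_infixes v A s.
Proof. by move=> sz tz r rs; apply: tz; apply: infix_trans rs sz. Qed.

(** With Y the norm of [pq.2], the main term in [foldl_qstep_cons] lies between [Y / A] and [A Y],
    and the other is at most [Y / (2 A)]. *)
Lemma large_pair_run {R : realType} {v : R[i]} {A : R} (pq : R[i] * R[i]) z :
  1 <= A -> large_pair v A pq -> tame_infixes v A z ->
  let pq' := foldl (qstep v) pq z in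
  normc pq.2 <= 2 * A * normc pq'.2 /\ normc pq'.2 <= 2 * A * normc pq.2.
Proof.
case: pq => x y A_ge1 [/= y_neq0 _]; have Ny := normc_ge0 y; have Nx := normc_ge0 x.
have Nv := normc_ge0 v.
case: z => [|n z] Lxy tz; first by have := ler_peMl Ny A_ge1; rewrite /=; lra.
rewrite foldl_qstep_cons.
have [||qn /(tame_bounds _ _ _ qn)[qn_le qn_ge]] := tz (n :: z); rewrite ?infix_refl //.
have qz_le : normc (q_ v z) <= A.
  case: (z =P [::]) => [->|/eqP z_neq0]; first by rewrite ComplexField.Normc.normc1.
  have [||qz /(tame_bounds _ _ _ qz)[]//] := tz z.
    by rewrite -cat1s suffix_infix.
  by [].
have := normcB_le (y * q_ v (n :: z)) (v * x * q_ v z).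
have := normcB_ge (y * q_ v (n :: z)) (v * x * q_ v z).
rewrite !normcM.
have Nz := normc_ge0 (q_ v z).
set a := normc (q_ v (n :: z)) in qn_le qn_ge *; set b := normc (q_ v z) in qz_le Nz *.
set c := normc (_ - _); move: Lxy Ny Nx Nv.
set X := normc x; set Y := normc y; set V := normc v => Lxy Ny Nx Nv c_ge c_le.
have VX : 0 <= V * X by rewrite mulr_ge0.
have e1 : V * X * b <= V * X * A by rewrite ler_wpM2l.
have e2 : Y * a <= Y * A by rewrite ler_wpM2l.
have e3 : Y <= A * (Y * a) by nra.
have e4 : 2 * A * (A * (V * X)) <= Y by nra.
split.
  nra.
have : A * (V * X) <= Y by nra.
nra.
Qed.

(** For nonempty z, [pq'.1] is the second component before the last entry. Comparing both with
    [pq.2] by [large_pair_run] gives the factor [(2 A)^2]. *)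
Lemma large_pair_ratio {R : realType} {v : R[i]} {A : R} (pq : R[i] * R[i]) z :
  1 <= A -> large_pair v A pq -> tame_infixes v A z ->
  let pq' := foldl (qstep v) pq z in
  pq'.2 != 0 /\ normc pq'.1 <= 4 * A ^+ 2 * normc pq'.2.
Proof.
move=> A_ge1 Lpq tz; have [y_neq0 lexy _] := Lpq.
have y_gt0 : 0 < normc pq.2 by rewrite lt_neqAle eq_sym normc_eq0 y_neq0 normc_ge0.
case/lastP: z tz => [|z n] tz /=.
  split=> //; apply: le_trans lexy _.
  by have := ler_peMl (ltW y_gt0) (exprn_ege1 2 A_ge1); lra.
have [h1 _] := large_pair_run _ _ A_ge1 Lpq tz.
have [|_ h2] := large_pair_run pq z A_ge1 Lpq.
  by apply: tame_infixesS tz; rewrite -cats1 prefix_infix.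
move: h1; rewrite foldl_rcons; set w := (qstep v _ n).2 => /= h1.
split; first by rewrite -normc_eq0; apply/negP => /eqP w0; move: h1; rewrite w0; lra.
have A2_ge0 : 0 <= 2 * A by lra.
by apply: le_trans h2 _; have := ler_wpM2l A2_ge0 h1; lra.
Qed.

(** From 7 - 4 = 3 one gets [|n y - x| >= 3 A^2 |y|]. This exceeds [2 A^2 |y|], for the last
    condition, and [A |y|], which after multiplication by v still dominates [|y|] since
    [A |v| >= 1]. *)
Lemma large_pair_step {R : realType} {v : R[i]} {A : R} (pq : R[i] * R[i]) n :
  1 <= A -> 1 <= A * normc v -> pq.2 != 0 ->
  normc pq.1 <= 4 * A ^+ 2 * normc pq.2 -> 7 * A ^+ 2 <= `|n|%N%:R ->
  large_pair v A (qstep v pq n).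
Proof.
case: pq => x y /= A_ge1 Av y_neq0 lexy len.
have y_gt0 : 0 < normc y by rewrite lt_neqAle eq_sym normc_eq0 y_neq0 normc_ge0.
have := normcB_ge (n%:~R * y) x; rewrite normcM normc_int.
have Nv := normc_ge0 v.
set w := _ - x; set m := `|n|%N%:R in len *; move: Nv Av y_gt0 lexy.
set V := normc v; set X := normc x; set Y := normc y => Nv VA y_gt0 lexy w_ge.
have Aw : 3 * A ^+ 2 * Y <= normc w.
  have : 7 * A ^+ 2 * Y <= m * Y by rewrite ler_wpM2r // ltW.
  lra.
have AY_ge0 : 0 <= A * Y by nra.
have leAY : A * Y <= A * (A * Y) by apply: ler_peMl.
have le1 : A * Y <= normc w by lra.
have le2 : 2 * A ^+ 2 * Y <= normc w by lra.
have VW1 := ler_wpM2l Nv le1; have VW2 := ler_wpM2l Nv le2.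
have leY : Y <= A * V * Y by apply: ler_peMl => //; apply: ltW.
have VW_gt0 : 0 < V * normc w by lra.
by split; rewrite /= -?normc_eq0 normcM -/w -/V -/Y; [rewrite lt0r_neq0 | lra | lra].
Qed.

(* The accumulator r is the block of small entries read since the last large one;
   a large entry n turns any pair with bounded ratio into a large_pair again, so
   it restarts the induction with r empty. *)
Lemma perturbed_neq0 {R : realType} {v : R[i]} {A : R} (B : nat) r z (pq : R[i] * R[i]) :
  1 <= A -> 1 <= A * normc v -> large_pair v A pq ->
  all (fun n => `|n|%N <= B)%N r ->
  (forall n, n \in z -> (`|n| <= B)%N \/ 7 * A ^+ 2 <= `|n|%N%:R) ->
  (forall s, infix s (r ++ z) -> all (fun n => `|n|%N <= B)%N s -> s != [::] ->
    q_ v s != 0 /\ tame v A s) ->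
  (foldl (qstep v) pq (r ++ z)).2 != 0.
Proof.
move=> A_ge1 Av; elim: z r pq => [|n z IH] r pq Lpq r_small z_dich tz.
  rewrite cats0 in tz *.
  have [|//] := large_pair_ratio _ _ A_ge1 Lpq (_ : tame_infixes v A r).
  move=> s sr; apply: tz => //.
  by apply/allP => i /(mem_infix sr); apply: (allP r_small).
have z_dich' i : i \in z -> (`|i| <= B)%N \/ 7 * A ^+ 2 <= `|i|%N%:R.
  by move=> iz; apply: z_dich; rewrite inE iz orbT.
have [n_small|n_large] := z_dich n (mem_head n z).
  by rewrite -cat_rcons in tz *; apply: IH => //; rewrite all_rcons n_small.
rewrite foldl_cat /=; apply: (IH [::]) => //.
  have [|nz ratio] := large_pair_ratio _ _ A_ge1 Lpq (_ : tame_infixes v A r).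
    move=> s sr; apply: tz; first exact: infix_catr.
    by apply/allP => i /(mem_infix sr); apply: (allP r_small).
  exact: large_pair_step.
by move=> s sz; apply: tz; rewrite -cat_rcons; apply: infix_catl.
Qed.


(** Otherwise each entry is at most B or at least [7 A^2], and [perturbed_neq0] applies from the
    large pair [(0, 1)]: infixes with small entries are shorter than z, hence not zeros. *)
Lemma perturbed_zero {R : realType} {v : R[i]} {A : R} (B k : nat) (z : seq int) :
  1 <= A -> (0 < k)%N -> (0 < B)%N -> v != 0 -> (size z <= k)%N ->
  0 \notin z -> q_ v z = 0 ->
  (forall d, (0 < d)%N -> zero_length v d -> (size z <= d)%N) ->
  (forall s, (0 < size s <= k)%N -> 0 \notin s ->
    all (fun n => `|n| <= B)%N s -> tame v A s) ->
  ~~ all (fun n => `|n| <= B)%N z ->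
  exists2 n, n \in z & ((B < `|n|)%N /\ `|n|%N%:R < 7 * A ^+ 2).
Proof.
move=> A_ge1 k_gt0 B_gt0 v_neq0 zk z0 qz z_min tame_small z_large.
apply: contrapT => no_n.
have Av : 1 <= A * normc v.
  (* Tameness of this one-entry sequence bounds v away from 0. *)
  have q1 : q_ v [:: 1] = v by rewrite /q_ /qpair /=; ring.
  have := tame_bounds v A [:: 1]; rewrite q1 => -[] //.
  by apply: tame_small; rewrite //= B_gt0.
suff : q_ v z != 0 by rewrite qz eqxx.
rewrite /q_ /qpair -[z]cat0s; apply: (perturbed_neq0 B [::]) A_ge1 Av _ _ _ _ => //.
- have n0 : normc (0 : R[i]) = 0 by apply/eqP; rewrite normc_eq0.
  by split; rewrite /= ?oner_eq0 // n0 ?mulr0 normc_ge0.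
- move=> n nz; case: (leqP `|n| B) => [|ltBn]; [by left | right].
  by rewrite leNgt; apply/negP => n_lt; apply: no_n; exists n.
move=> s /= sz s_small s_neq.
have s0 : 0 \notin s by apply: contra z0 => /(mem_infix sz).
have s_gt0 : (0 < size s)%N by rewrite lt0n size_eq0.
have le_sz := size_infix sz.
split; last by apply: tame_small => //; rewrite s_gt0 (leq_trans le_sz).
(* A small infix that is a zero would be as long as z, hence equal to z, which has an entry above
   B. *)
apply/negP => /eqP qs; have le_zs : (size z <= size s)%N.
  by apply: z_min => //; exists s.
suff sEz : s = z by rewrite -sEz s_small in z_large.
case/infixP: sz le_zs => a [b ->]; rewrite !size_cat addnCA.
rewrite -[leqRHS]addn0 leq_add2l leqn0 addn_eq0 !size_eq0 => /andP[/eqP-> /eqP->].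
by rewrite cats0.
Qed.

(** This count measures the progress of the rounds; it never exceeds the length, so finitely many
    enlargements suffice. *)
Lemma count_small_lt (B C : nat) (z : seq int) n :
  (B <= C)%N -> n \in z -> (B < `|n| <= C)%N ->
  (count (fun i => `|i| <= B) z < count (fun i => `|i| <= C) z)%N.
Proof.
move=> leBC nz /andP[ltBn lenC].
have /permP pz := perm_to_rem nz; rewrite !pz /= lenC [(`|n| <= B)%N]leqNgt ltBn ltnS.
by apply: sub_count => i /leq_trans; apply.
Qed.

(** * Enumeration of sequences by numerical codes *)

(* With base b = 2 N, the digits 0, ..., N - 1 stand for - N, ..., - 1 and
   N, ..., 2 N - 1 for 1, ..., N. *)
Definition digit (N d : nat) : int := (d%:Z - N%:Z) + (d %/ N)%N%:Z.

Fixpoint decode (N x j : nat) : seq int :=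
  if j is j'.+1 then
    digit N (x %% (2 * N)) :: decode N (x %/ (2 * N)) j'
  else [::].

Lemma size_decode N x j : size (decode N x j) = j.
Proof. by elim: j x => //= j IH x; rewrite IH. Qed.

(** Digits are read lowest first, so the prefixes of [decode N x k] are the [decode N x j]: one pass
    over a code tests all lengths up to k. *)
Lemma decodeS N x j :
  decode N x j.+1 = rcons (decode N x j) (digit N (x %/ (2 * N) ^ j %% (2 * N))).
Proof.
elim: j x => [|j IH] x; first by rewrite /= divn1.
rewrite -[LHS]/(digit N (x %% (2 * N)) :: decode N (x %/ (2 * N)) j.+1) IH.
by rewrite /= expnS [RHS]/= (divnMA x (2 * N)%N).
Qed.

Lemma digit_neq0 N d : (0 < N)%N -> (d < 2 * N)%N -> digit N d != 0.
Proof.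
move=> N_gt0 d_lt; rewrite /digit; case: (ltnP d N) => dN.
  by rewrite divn_small //; lia.
have : (0 < d %/ N)%N by rewrite divn_gt0.
by move: (d %/ N)%N => e; lia.
Qed.

Lemma decode_neq0 N x j : (0 < N)%N -> 0 \notin decode N x j.
Proof.
move=> N_gt0; elim: j x => //= j IH x.
by rewrite inE negb_or IH andbT eq_sym digit_neq0 // ltn_mod muln_gt0.
Qed.

Lemma digit_surj N (n : int) : n != 0 -> (`|n| <= N)%N ->
  exists2 d, (d < 2 * N)%N & digit N d = n.
Proof.
move=> n_neq0 n_le; have N_gt0 : (0 < N)%N by lia.
case: n n_neq0 n_le => n n_neq0 n_le.
  exists (N + n.-1)%N; first by lia.
  by rewrite /digit divnDl ?dvdnn // divnn N_gt0 divn_small; lia.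
exists (N - n.+1)%N; first by lia.
by rewrite /digit divn_small; lia.
Qed.

(** Horner's scheme; the higher digits are 0 when z is shorter than j, so one bound on codes serves
    all lengths up to j. *)
Lemma decode_surj N j (z : seq int) : (0 < N)%N -> (size z <= j)%N ->
  0 \notin z -> all (fun n => `|n| <= N)%N z ->
  exists2 x, (x < (2 * N) ^ j)%N & decode N x (size z) = z.
Proof.
move=> N_gt0; have b_gt0 : (0 < 2 * N)%N by rewrite muln_gt0.
elim: z j => [|n z IH] j; first by exists 0%N; rewrite ?expn_gt0 ?b_gt0.
case: j => // j /= lezj; rewrite inE negb_or eq_sym => /andP[n0 z0] /andP[nN zN].
have [x x_lt xE] := IH j lezj z0 zN; have [d d_lt dE] := digit_surj _ _ n0 nN.
exists (x * (2 * N) + d)%N.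
  by rewrite expnS; have := leq_mul x_lt (leqnn (2 * N)); nia.
by rewrite modnMDl modn_small // divnMDl // divn_small // addn0 xE dE.
Qed.

(** * Total correctness of programs *)

Definition mem_of {R : realType} (s : seq R[i]) : memory R := fun i => s`_i.

Lemma update_mem_of {R : realType} (s : seq R[i]) i z :
  update (mem_of s) i z = mem_of (set_nth 0 s i z).
Proof. by apply/funext => j; rewrite /update /mem_of nth_set_nth. Qed.

Definition reg (i : nat) : expr := Get (Lit i).

Lemma address_nat {R : realType} (i : nat) : address (i%:Z%:~R : R[i]) = i.
Proof.
by rewrite /address -pmulrn -(rmorph_nat (@real_complex_def R (Phant R))) natrK.
Qed.

Lemma Re_nat {R : realType} (n : nat) : complex.Re (n%:R : R[i]) = n%:R.
Proof. by rewrite -(rmorph_nat (@real_complex_def R (Phant R))). Qed.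

Lemma floor_divn {R : realType} (a b : nat) :
  (Num.floor (complex.Re (a%:R / b%:R : R[i])))%:~R = (a %/ b)%:R :> R[i].
Proof.
rewrite -!(rmorph_nat (@real_complex_def R (Phant R))) -fmorph_div /=.
case: (posnP b) => [->|b_gt0]; first by rewrite invr0 mulr0 floor0 divn0 rmorph0.
have b0 : 0 < b%:R :> R by rewrite ltr0n.
rewrite (@floor_def _ _ (a %/ b)%N) -?pmulrn ?rmorph_nat //.
rewrite ler_pdivlMr // ltr_pdivrMr // -!natrM ler_nat ltr_nat leq_divM.
by rewrite addn1 ltn_ceil.
Qed.

(** A total-correctness triple with the precondition left to the context; nesting it in
    postconditions allows symbolic execution. *)
Definition runs {R : realType} (P : prog) (s : seq R[i])
    (Q : seq R[i] -> Prop) : Prop :=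
  exists2 s', exec P (mem_of s) (mem_of s') & Q s'.

Lemma runs_set {R : realType} (s : seq R[i]) a e Q :
  Q (set_nth 0 s a (eval (mem_of s) e)) -> runs (Set_ (Lit a%:Z) e) s Q.
Proof.
move=> Qs; exists (set_nth 0 s a (eval (mem_of s) e)) => //.
by have := exec_set (mem_of s) (Lit a%:Z) e; rewrite address_nat update_mem_of.
Qed.

Lemma runs_seq {R : realType} (s : seq R[i]) P1 P2 Q :
  runs P1 s (fun s' => runs P2 s' Q) -> runs (Seq P1 P2) s Q.
Proof. by case=> s1 E1 [s2 E2 Q2]; exists s2 => //; apply: exec_seq E1 E2. Qed.

Lemma runs_if {R : realType} (s : seq R[i]) b P1 P2 Q :
  runs (if holds (mem_of s) b then P1 else P2) s Q -> runs (If b P1 P2) s Q.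
Proof. by case=> s1 E1 Q1; exists s1 => //; apply: exec_if. Qed.

Lemma runs_skip {R : realType} (s : seq R[i]) Q : Q s -> runs Skip s Q.
Proof. by move=> Qs; exists s => //; apply: exec_skip. Qed.

Lemma runs_weaken {R : realType} {s : seq R[i]} {P} (Q : seq R[i] -> Prop) {Q'} :
  runs P s Q -> (forall s', Q s' -> Q' s') -> runs P s Q'.
Proof. by case=> s' E Qs' QQ'; exists s' => //; apply: QQ'. Qed.

(* The first argument of the invariant is the number of remaining iterations. *)
Lemma runs_while {R : realType} (I : nat -> seq R[i] -> Prop) b P n s :
  (forall n s, I n.+1 s -> holds (mem_of s) b /\ runs P s (I n)) ->
  (forall s, I 0%N s -> ~~ holds (mem_of s) b) ->
  I n s -> runs (While b P) s (I 0%N).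
Proof.
move=> IS I0; elim: n s => [|n IH] s Is.
  by exists s => //; apply: exec_while_end; apply: I0.
have [hb [s1 E1 Is1]] := IS _ _ Is; have [s2 E2 Is2] := IH _ Is1.
by exists s2 => //; apply: exec_while_step hb E1 E2.
Qed.

(** * The program *)

Local Notation set_reg a e := (Set_ (Lit (Posz a)) e).

(* Registers: 0 lambda, then the answer; 1 k; 2 the bound N on the entries;
   3 the bound A; 4 the code of a sequence; 5 its unread digits; 6 the number j
   of digits read; 7 and 8 the pair q_j, q_(j+1); 9 the least length D of a zero
   found so far, or k + 1; 10 the number of rounds done; 11 scratch.
   Since 1 / 0 = 0, a vanishing q_(j+1) leaves A unchanged. *)
Definition step_prog : prog :=
  Seq (set_reg 11 (Defs.Sub (reg 5) (Mul (Mul (Lit (Posz 2)) (reg 2))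
    (Floor (Div (reg 5) (Mul (Lit (Posz 2)) (reg 2)))))))
  (Seq (set_reg 5 (Floor (Div (reg 5) (Mul (Lit (Posz 2)) (reg 2)))))
  (Seq (set_reg 11 (Mul (Defs.Sub (Lit (Posz 0)) (reg 0))
    (Defs.Sub (Mul (Add (Defs.Sub (reg 11) (reg 2)) (Floor (Div (reg 11) (reg 2)))) (reg 8))
      (reg 7))))
  (Seq (set_reg 7 (reg 8))
  (Seq (set_reg 8 (reg 11))
  (Seq (set_reg 6 (Add (reg 6) (Lit (Posz 1))))
  (Seq (set_reg 3 (Add (reg 3) (Add (Abs (reg 8)) (Div (Lit (Posz 1)) (Abs (reg 8))))))
  (If (TAnd (TEq (Abs (reg 8)) (Lit (Posz 0))) (TLe (reg 6) (reg 9)))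
    (set_reg 9 (reg 6)) Skip))))))).

Definition sequence_prog : prog :=
  Seq (set_reg 5 (reg 4))
  (Seq (set_reg 6 (Lit (Posz 0)))
  (Seq (set_reg 7 (Lit (Posz 0)))
  (Seq (set_reg 8 (Lit (Posz 1)))
  (Seq (While (TNot (TLe (reg 1) (reg 6))) step_prog)
  (set_reg 4 (Add (reg 4) (Lit (Posz 1)))))))).

(* A code has been decoded completely iff its quotient left in register 5 is 0,
   so the enumeration stops after the first code that needs more than k digits. *)
Definition round_prog : prog :=
  Seq (set_reg 4 (Lit (Posz 0)))
  (Seq (set_reg 5 (Lit (Posz 0)))
  (Seq (While (TEq (reg 5) (Lit (Posz 0))) sequence_prog)
  (Seq (set_reg 2 (Add (reg 2) (Ceil (Mul (Lit (Posz 7)) (Mul (reg 3) (reg 3))))))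
  (set_reg 10 (Add (reg 10) (Lit (Posz 1))))))).

(** Register 9 starts at k + 1, meaning that no zero is known. Register 10 is 0 on input, so there
    are k + 1 rounds: one for the initial bound and one for each of k enlargements. *)
Definition mindeg_prog : prog :=
  Seq (set_reg 2 (Lit (Posz 1)))
  (Seq (set_reg 3 (Lit (Posz 1)))
  (Seq (set_reg 9 (Add (reg 1) (Lit (Posz 1))))
  (Seq (While (TLe (reg 10) (reg 1)) round_prog)
  (If (TEq (reg 9) (reg 1)) (set_reg 0 (Lit (Posz 1))) (set_reg 0 (Lit (Posz 0))))))).

(** * Loop invariants and correctness of the program *)

Definition state {R : realType} (lam : R[i]) (k N : nat) (A : R) (x y j : nat)
    (p q : R[i]) (D r : nat) (t : R[i]) : seq R[i] :=
  [:: lam; k%:R; N%:R; A%:C; x%:R; y%:R; j%:R; p; q; D%:R; r%:R; t].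

Lemma runs_step {R : realType} (lam : R[i]) k N A x y j p q D r t :
  let q' := - lam * ((digit N (y %% (2 * N)))%:~R * q - p) in
  let A' := A + (normc q' + (normc q')^-1) in
  let D' := if (q' == 0) && (j.+1 <= D)%N then j.+1 else D in
  runs step_prog (state lam k N A x y j p q D r t)
    (fun s => exists t', s = state lam k N A' x (y %/ (2 * N)) j.+1 q q' D' r t').
Proof.
move=> q' A' D'.
apply: runs_seq; apply: runs_set; rewrite /= ?address_nat /=.
apply: runs_seq; apply: runs_set; rewrite /= ?address_nat /=.
rewrite -[2%Z%:~R]/(2%:R) -natrM floor_divn.
have -> : y%:R - (2 * N)%:R * (y %/ (2 * N))%:R = (y %% (2 * N))%:R :> R[i].
  by rewrite {1}(divn_eq y (2 * N)) natrD natrM; ring.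
set d := (y %% (2 * N))%N in q' A' D' *.
apply: runs_seq; apply: runs_set; rewrite /= ?address_nat /= floor_divn.
have -> : (0%Z%:~R - lam) * ((d%:R - N%:R + (d %/ N)%:R) * q - p) = q'.
  by rewrite sub0r /q' /digit rmorphD rmorphB /= -!pmulrn.
apply: runs_seq; apply: runs_set; rewrite /= ?address_nat /=.
apply: runs_seq; apply: runs_set; rewrite /= ?address_nat /=.
apply: runs_seq; apply: runs_set; rewrite /= ?address_nat /=.
apply: runs_seq; apply: runs_set; rewrite /= ?address_nat /=.
rewrite -[1%Z%:~R]/(1%:R) -natrD addn1 normr_normc div1r -fmorphV -!rmorphD /=.
apply: runs_if; rewrite /reg; cbn [holds eval]; rewrite !address_nat /mem_of; cbn [nth].
(* Tests compare real parts only, so [q' = 0] is tested through its norm. *)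
rewrite normr_normc !Re_nat ler_nat /= normc_eq0.
rewrite /D'; case: ifP => _; last by apply: runs_skip; exists q'.
by apply: runs_set; rewrite /= ?address_nat /=; exists q'.
Qed.

Definition covers {R : realType} (v : R[i]) (A : R) (D : nat) (z : seq int) : Prop :=
  tame v A z /\ (q_ v z = 0 -> (D <= size z)%N).

Lemma coversW {R : realType} (v : R[i]) (A A' : R) (D D' : nat) z :
  A <= A' -> (D' <= D)%N -> covers v A D z -> covers v A' D' z.
Proof.
move=> leA leD [tz Dz]; split; first exact: le_trans leA.
by move=> /Dz; apply: leq_trans.
Qed.

(** The value [D = k.+1] means that no zero has been found. *)
Definition sound {R : realType} (v : R[i]) (k : nat) (A : R) (D : nat) : Prop :=
  [/\ 1 <= A, (D <= k.+1)%N & (D <= k)%N -> (0 < D)%N /\ zero_length v D].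

Lemma runs_sequence {R : realType} (lam : R[i]) k N A x y j p q D r t :
  (0 < N)%N -> sound (- lam) k A D ->
  runs sequence_prog (state lam k N A x y j p q D r t) (fun s =>
    exists A' j' p' q' D' t',
    [/\ s = state lam k N A' x.+1 (x %/ (2 * N) ^ k) j' p' q' D' r t',
      A <= A', (D' <= D)%N, sound (- lam) k A' D' &
      forall i, (0 < i <= k)%N -> covers (- lam) A' D' (decode N x i)]).
Proof.
move=> N_gt0 AD.
apply: runs_seq; apply: runs_set; rewrite /= ?address_nat /=.
apply: runs_seq; apply: runs_set; rewrite /= ?address_nat /=.
apply: runs_seq; apply: runs_set; rewrite /= ?address_nat /=.
apply: runs_seq; apply: runs_set; rewrite /= ?address_nat /=.
apply: runs_seq.
(* After j' digits, registers 7 and 8 hold the pair of the prefix of length j', and all its nonempty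
   prefixes are covered. *)
pose I n (s : seq R[i]) := exists A' j' D' t',
  [/\ s = state lam k N A' x (x %/ (2 * N) ^ j') j' (qpair (- lam) (decode N x j')).1
            (q_ (- lam) (decode N x j')) D' r t' /\ (n + j' = k)%N,
    A <= A', (D' <= D)%N, sound (- lam) k A' D' &
    forall i, (0 < i <= j')%N -> covers (- lam) A' D' (decode N x i)].
apply: (runs_weaken (I 0%N)).
  apply: (runs_while I _ _ k) => [n s|s|].
  - case=> A1 [j1 [D1 [t1 [[-> nj] leA leD [A1_ge1 leD1 D1_zero] cov]]]]; split.
      rewrite /reg; cbn [holds eval]; rewrite !address_nat /mem_of; cbn [nth state].
      by rewrite !Re_nat ler_nat; lia.
    apply: (runs_weaken _ (runs_step _ _ _ _ _ _ _ _ _ _ _ _)).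
    set d := digit N _; set q1 := - lam * _; set A2 := A1 + _.
    set D2 := if _ then _ else _.
    move=> s1 [t2 ->].
    have Dz : decode N x j1.+1 = rcons (decode N x j1) d by rewrite decodeS.
    have q1E : q_ (- lam) (decode N x j1.+1) = q1 by rewrite /q_ Dz qpair_rcons.
    have le12 : A1 <= A2 by rewrite lerDl addr_ge0 ?invr_ge0 ?normc_ge0.
    have leD21 : (D2 <= D1)%N by rewrite /D2; case: ifP => // /andP[].
    exists A2, j1.+1, D2, t2; split.
    + split; last by lia.
      by rewrite q1E Dz qpair_rcons expnSr (divnMA x ((2 * N) ^ j1)).
    + exact: le_trans leA le12.
    + exact: leq_trans leD21 leD.
    + split; [exact: le_trans le12 | exact: leq_trans leD1 |].
      rewrite /D2; case: ifP => [/andP[/eqP q10 _] _|_]; last exact: D1_zero.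
      split=> //; exists (decode N x j1.+1).
      by rewrite size_decode decode_neq0 // q1E q10.
    move=> i /andP[i_gt0]; rewrite leq_eqVlt => /predU1P[->|ltij].
      split; first by rewrite /tame q1E /A2 lerDr; lra.
      rewrite q1E size_decode => q10; rewrite /D2 q10 eqxx /=.
      by case: ltnP => //; lia.
    by apply: coversW (cov i _); rewrite ?i_gt0.
  - case=> A1 [j1 [D1 [t1 [[-> nj] _ _ _ _]]]].
    rewrite /reg; cbn [holds eval]; rewrite !address_nat /mem_of; cbn [nth state].
    by rewrite !Re_nat ler_nat; lia.
  exists A, 0%N, D, t; split=> //=; last by move=> i; lia.
  by rewrite divn1 addn0.
move=> s [A1 [j1 [D1 [t1 [[-> nj] leA leD AD1 cov]]]]].
move: nj cov; rewrite add0n => -> cov.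
apply: runs_set; rewrite /= ?address_nat /=.
rewrite -[1%Z%:~R]/(1%:R) -natrD addn1.
by do 6 eexists; split; first reflexivity.
Qed.

Definition covered {R : realType} (v : R[i]) (k N : nat) (A : R) (D : nat) : Prop :=
  forall z, (0 < size z <= k)%N -> 0 \notin z ->
    all (fun n => `|n| <= N)%N z -> covers v A D z.

Lemma ceil_register {R : realType} (A : R) :
  (Num.ceil (complex.Re (7%Z%:~R * (A%:C * A%:C) : R[i])))%:~R =
  `|Num.ceil (7 * (A * A))|%N%:R :> R[i].
Proof.
have -> : 7%Z%:~R * (A%:C * A%:C) = (7 * (A * A))%:C :> R[i].
  by rewrite !rmorphM rmorph_nat.
rewrite [RHS]pmulrn gez0_abs // -(ler_int R) (le_trans _ (ceil_ge _)) //.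
by rewrite mulr_ge0 // -expr2 sqr_ge0.
Qed.

Lemma runs_round {R : realType} (lam : R[i]) k N A x y j p q D r t :
  (0 < N)%N -> sound (- lam) k A D ->
  runs round_prog (state lam k N A x y j p q D r t) (fun s =>
    exists A' x' y' j' p' q' D' t',
    [/\ s = state lam k (N + `|Num.ceil (7 * (A' * A'))|)%N A' x' y' j' p' q' D'
          r.+1 t',
      sound (- lam) k A' D', (D' <= D)%N & covered (- lam) k N A' D']).
Proof.
move=> N_gt0 AD.
have b_gt0 m : (0 < (2 * N) ^ m)%N by rewrite expn_gt0 muln_gt0 N_gt0.
apply: runs_seq; apply: runs_set; rewrite /= ?address_nat /=.
apply: runs_seq; apply: runs_set; rewrite /= ?address_nat /=.
apply: runs_seq.
(* Register 5 holds the initial 0 or the quotient of the code x' - 1, so it is 0 iff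
   [x' <= (2 * N) ^ k]. The code [(2 * N) ^ k] is thus run too, whence the [.+1]. *)
pose I n (s : seq R[i]) := exists A' x' y' j' p' q' D' t',
  [/\ s = state lam k N A' x' y' j' p' q' D' r t',
    (n + x' = ((2 * N) ^ k).+1)%N /\ (y' == 0%N) = (x' <= (2 * N) ^ k)%N,
    sound (- lam) k A' D', (D' <= D)%N &
    forall e i, (e < x')%N -> (0 < i <= k)%N -> covers (- lam) A' D' (decode N e i)].
apply: (runs_weaken (I 0%N)).
  apply: (runs_while I _ _ ((2 * N) ^ k).+1) => [n s|s|].
  - case=> A1 [x1 [y1 [j1 [p1 [q1 [D1 [t1 [-> [nx yx] AD1 leD cov]]]]]]]]; split.
      rewrite /reg; cbn [holds eval]; rewrite !address_nat /mem_of; cbn [nth state].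
      by rewrite !Re_nat eqr_nat yx; lia.
    apply: (runs_weaken _ (runs_sequence _ _ _ _ _ _ _ _ _ _ _ _ N_gt0 AD1)).
    move=> s1 [A2 [j2 [p2 [q2 [D2 [t2 [-> leA leD21 AD2 cov2]]]]]]].
    exists A2, x1.+1, (x1 %/ (2 * N) ^ k)%N, j2, p2, q2, D2, t2; split=> //.
    + split; first by lia.
      by rewrite -leqn0 leqNgt divn_gt0 // -ltnNge.
    + exact: leq_trans leD.
    move=> e i; rewrite ltnS leq_eqVlt => /predU1P[-> |lte] ik; first exact: cov2.
    exact: coversW (cov _ _ lte ik).
  - case=> A1 [x1 [y1 [j1 [p1 [q1 [D1 [t1 [-> [nx yx] _ _ _]]]]]]]].
    rewrite /reg; cbn [holds eval]; rewrite !address_nat /mem_of; cbn [nth state].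
    by rewrite !Re_nat eqr_nat yx; lia.
  by exists A, 0%N, 0%N, j, p, q, D, t; rewrite addn0.
move=> s [A1 [x1 [y1 [j1 [p1 [q1 [D1 [t1 [-> [nx _] AD1 leD cov]]]]]]]]].
apply: runs_seq; apply: runs_set; rewrite /reg; cbn [eval].
rewrite !address_nat /mem_of; cbn [nth state set_nth].
rewrite ceil_register -natrD.
apply: runs_set; rewrite /= ?address_nat /=.
rewrite -[1%Z%:~R]/(1%:R) -natrD addn1.
exists A1, x1, y1, j1, p1, q1, D1, t1; split=> // z /andP[z_gt0 lezk] z0 zN.
have [e e_lt <-] := decode_surj _ _ _ N_gt0 lezk z0 zN.
by apply: cov; rewrite ?z_gt0 //; move: nx; lia.
Qed.

Definition minimal_zero {R : realType} (v : R[i]) (z : seq int) : Prop :=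
  [/\ (0 < size z)%N, 0 \notin z, q_ v z = 0 &
    forall d, (0 < d)%N -> zero_length v d -> (size z <= d)%N].

(** If no entry of z exceeds N, then z is itself covered; otherwise, for nonzero v, [perturbed_zero]
    yields an entry between N and [7 A^2], captured by the next bound. *)
Lemma covered_progress {R : realType} (v : R[i]) (k N : nat) (A : R) (D r : nat) z :
  (0 < N)%N -> 1 <= A -> (size z <= k)%N -> covered v k N A D ->
  minimal_zero v z ->
  (r <= count (fun n => `|n| <= N) z)%N ->
  (r.+1 <= count (fun n => `|n| <= N + `|Num.ceil (7 * (A * A))|) z)%N \/
  (D <= size z)%N.
Proof.
move=> N_gt0 A_ge1 lezk cov [z_gt0 z0 qz z_min] le_r.
case: (boolP (all (fun n => `|n| <= N)%N z)) => [zN|z_large].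
  by right; have [|_] := cov z _ z0 zN; [rewrite z_gt0|apply].
have k_gt0 := leq_trans z_gt0 lezk.
(* For v = 0 the sequence [[:: 1]] is already a zero, so D is at most 1. *)
have [v0|v_neq0] := eqVneq v 0.
  have [|//|//|_ D1] := cov [:: 1]; [by rewrite /= k_gt0 | by rewrite /= N_gt0 |].
  right; apply: leq_trans z_gt0; apply: D1.
  by rewrite v0 /q_ /qpair /= mul0r.
left; have [|n nz [ltNn ltnA]] :=
    perturbed_zero N k z A_ge1 k_gt0 N_gt0 v_neq0 lezk z0 qz z_min _ z_large.
  by move=> s sk s0 sN; case: (cov s sk s0 sN).
apply: leq_trans (count_small_lt _ _ _ _ (leq_addr _ _) nz _) => //.
rewrite ltNn /= (leq_trans _ (leq_addl _ _)) // -(ler_nat R).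
rewrite (le_trans (ltW ltnA)) // expr2 (le_trans (ceil_ge _)) //.
by rewrite [leRHS]pmulrn ler_int abszE ler_norm.
Qed.

Lemma runs_mindeg {R : realType} (lam : R[i]) (k : nat) :
  runs mindeg_prog (state lam k 0 0 0 0 0 0 0 0 0 0) (fun s =>
    exists A N x y j p q D r t,
    [/\ s = state (if D == k then 1 else 0) k N A x y j p q D r t,
      sound (- lam) k A D &
      forall z, (size z <= k)%N -> minimal_zero (- lam) z -> (D <= size z)%N]).
Proof.
apply: runs_seq; apply: runs_set; rewrite /= ?address_nat /=.
apply: runs_seq; apply: runs_set; rewrite /= ?address_nat /=.
apply: runs_seq; apply: runs_set; rewrite /= ?address_nat /=.
apply: runs_seq.
(* Here r counts the rounds done: each captures a further entry of every shortest zero of length at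
   most k, unless D has already reached its length. *)
pose I n (s : seq R[i]) := exists A N x y j p q D r t,
  [/\ s = state lam k N A x y j p q D r t, (n + r = k.+1)%N, (0 < N)%N,
    sound (- lam) k A D &
    forall z, (size z <= k)%N -> minimal_zero (- lam) z ->
      (r <= count (fun n => `|n| <= N) z)%N \/ (D <= size z)%N].
apply: (runs_weaken (I 0%N)).
  apply: (runs_while I _ _ k.+1) => [n s|s|].
  - case=> A [N [x [y [j [p [q [D [r [t [-> nr N_gt0 AD prog]]]]]]]]]]; split.
      rewrite /reg; cbn [holds eval]; rewrite !address_nat /mem_of; cbn [nth state].
      by rewrite !Re_nat ler_nat; lia.
    apply: (runs_weaken _ (runs_round _ _ _ _ _ _ _ _ _ _ _ _ N_gt0 AD)).
    move=> s1 [A1 [x1 [y1 [j1 [p1 [q1 [D1 [t1 [-> AD1 leD cov]]]]]]]]].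
    do 10 eexists; split; first reflexivity; rewrite ?addn_gt0 ?N_gt0 //; first by lia.
    move=> z lezk zmin; have [A1_ge1 _ _] := AD1.
    have [le_r|leDz] := prog z lezk zmin; last by right; exact: leq_trans leDz.
    exact: covered_progress cov zmin le_r.
  - case=> A [N [x [y [j [p [q [D [r [t [-> nr _ _ _]]]]]]]]]].
    rewrite /reg; cbn [holds eval]; rewrite !address_nat /mem_of; cbn [nth state].
    by rewrite !Re_nat ler_nat; lia.
  exists 1, 1%N, 0%N, 0%N, 0%N, 0, 0, k.+1, 0%N, 0.
  split=> //; [|by rewrite addn0|by split; rewrite // ltnn|by move=> z _ _; left].
  by rewrite /state -[1%Z%:~R]/(1%:R) -natrD addn1 rmorph1.
move=> s [A [N [x [y [j [p [q [D [r [t [-> nr _ AD prog]]]]]]]]]]].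
have Dmin z : (size z <= k)%N -> minimal_zero (- lam) z -> (D <= size z)%N.
  move=> lezk zmin; have [le_r|//] := prog z lezk zmin.
  (* Now r = k + 1 exceeds the length of z, which excludes the first alternative. *)
  by have := count_size (fun n => `|n| <= N)%N z; lia.
apply: runs_if; rewrite /reg; cbn [holds eval].
rewrite !address_nat /mem_of; cbn [nth state].
rewrite !Re_nat eqr_nat.
case: eqP => Dk; apply: runs_set; exists A, N, x, y, j, p, q, D, r, t;
  by split=> //; case: eqP Dk.
Qed.

(** * Decision of the minimal degree *)

Theorem theoremC (R : realType) :
  exists P : prog, forall (lambda u : R[i]) (k : nat),
    lambda = - u ^+ 2 -> (0 < k)%N ->
    decides_on P lambda k (mindeg_u u = Some k).
Proof.
exists mindeg_prog => lam u k lamE k_gt0.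
have [s E] := runs_mindeg lam k.
case=> A [N [x [y [j [p [q [D [r [t [sE [_ leDk D_zero] Dmin]]]]]]]]]].
exists (mem_of s).
  have -> // : input lam k = mem_of (state lam k 0 0 0 0 0 0 0 0 0 0).
  apply/funext => -[|[|[|[|[|[|[|[|[|[|[|[|a]]]]]]]]]]]];
    by rewrite /mem_of //= ?nth_nil.
have vE : u ^+ 2 = - lam by rewrite lamE opprK.
suff Dk : mindeg_u u = Some k <-> D = k.
  rewrite sE /mem_of /=; case: eqP => [/Dk ?|nDk]; [left | right]; split=> //.
  by move=> /Dk.
rewrite mindeg_uE // vE; split=> [[[z [zk z0 qz]] k_min]|Dk].
  have leDz : (D <= k)%N by rewrite -zk; apply: Dmin; [rewrite zk | split; rewrite ?zk].
  have [D_gt0 zD] := D_zero leDz.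
  by apply/eqP; rewrite eqn_leq leDz k_min.
have [|_ zk] := D_zero; first by rewrite Dk.
rewrite Dk in zk; split=> // d d_gt0 zd; rewrite leqNgt; apply/negP => ltdk.
(* [Dmin] concerns shortest zeros only, so d is replaced by the least length e of a zero; then D <=
   e <= d < k = D is absurd. *)
have ex_d : exists e, (0 < e)%N && `[< zero_length (- lam) e >].
  by exists d; rewrite d_gt0; apply/asboolP.
case: (ex_minnP ex_d) => e /andP[e_gt0 /asboolP[z [ze z0 qz]]] e_min.
have leed : (e <= d)%N by apply: e_min; rewrite d_gt0; apply/asboolP.
suff : (D <= e)%N by lia.
rewrite -ze; apply: Dmin; first by lia.
split; rewrite ?ze // => f f_gt0 zf.
by apply: e_min; rewrite f_gt0; apply/asboolP.
Qed.
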